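(* Let $n\geqslant 1$ be an integer, $X=\{1,\ldots,n\}$, let $I=[a,b]$ and $J=[c,d]$ be nontrivial bounded closed real intervals, and consider a function $f\colon J^n\to I$. Consider the two properties $$\text{(A)}\quad f(x\vee\mathbf{e}_S)=f(x,\ldots,x)\vee f(\mathbf{e}_S)\quad\text{for all } x\in J,\ S\subseteq X,$$ $$\text{(B)}\quad f(x\wedge\mathbf{e}_S)=f(x,\ldots,x)\wedge f(\mathbf{e}_S)\quad\text{for all } x\in J,\ S\subseteq X.$$ The following conditions are equivalent. (i) $f$ is a quasi-Sugeno integral of the form $f(\mathbf{x})=\mathcal{S}_\mu(\varphi(x_1),\ldots,\varphi(x_n))$ for all $\mathbf{x}\in J^n$, for some $I$-valued capacity $\mu$ on $X$, where $\varphi\colon J\to I$ is the function $\varphi(x)=f(x,\ldots,x)$ (and $\varphi$ is nondecreasing). (ii) $f$ is a quasi-Sugeno integral. (iii) $f$ is comonotonically modular, nondecreasing, and satisfies (A) or (B). (iv) $f$ is nondecreasing and satisfies both (A) and (B).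
   Context: Notation: $\wedge$ and $\vee$ denote minimum and maximum (componentwise on $n$-tuples). $\mathfrak{S}_X$ is the set of permutations of $X=\{1,\ldots,n\}$. For an interval $K$ and $\sigma\in\mathfrak{S}_X$, $K^n_\sigma=\{\mathbf{x}=(x_1,\ldots,x_n)\in K^n : x_{\sigma(1)}\leqslant\cdots\leqslant x_{\sigma(n)}\}$. For $i\in X$, $S_\sigma^{\uparrow}(i)=\{\sigma(i),\ldots,\sigma(n)\}$. For $S\subseteq X$, $\mathbf{e}_S$ is the $n$-tuple in $\{c,d\}^n\subseteq J^n$ whose $i$th component is $d$ if $i\in S$ and $c$ otherwise. For $x\in J$, $x\vee\mathbf{e}_S$ (resp. $x\wedge\mathbf{e}_S$) is the $n$-tuple obtained by taking the maximum (resp. minimum) of $x$ with each component of $\mathbf{e}_S$. A function $f\colon J^n\to I$ is nondecreasing if it is nondecreasing with respect to the componentwise order. Quasi-Sugeno integral: an $I$-valued capacity on $X$ is an order-preserving map $\mu\colon 2^X\to I$ (that is, $\mu(S)\leqslant\mu(T)$ whenever $S\subseteq T$) with $\mu(\varnothing)=a$ and $\mu(X)=b$. The Sugeno integral with respect to $\mu$ is the (well-defined) function $\mathcal{S}_\mu\colon I^n\to I$ given by $$\mathcal{S}_\mu(\mathbf{x})=\bigvee_{i\in X}\big(x_{\sigma(i)}\wedge\mu(S_\sigma^{\uparrow}(i))\big),\qquad \mathbf{x}\in I^n_\sigma,\ \sigma\in\mathfrak{S}_X.$$ A quasi-Sugeno integral is a function $f\colon J^n\to I$ of the form $f(\mathbf{x})=\mathcal{S}_\mu(\varphi(x_1),\ldots,\varphi(x_n))$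 for some $I$-valued capacity $\mu$ on $X$ and some nondecreasing function $\varphi\colon J\to I$. Comonotonic modularity: two $n$-tuples $\mathbf{x},\mathbf{x}'\in J^n$ are comonotonic if there exists $\sigma\in\mathfrak{S}_X$ such that $\mathbf{x},\mathbf{x}'\in J^n_\sigma$. A function $f\colon J^n\to I$ is comonotonically modular if $f(\mathbf{x})+f(\mathbf{x}')=f(\mathbf{x}\wedge\mathbf{x}')+f(\mathbf{x}\vee\mathbf{x}')$ for all comonotonic $\mathbf{x},\mathbf{x}'\in J^n$. *)

(* Defs.v *)
From HB Require Import structures.
From mathcomp Require Import all_boot all_order all_fingroup all_algebra.
From mathcomp Require Import reals.

Set Implicit Arguments.
Unset Strict Implicit.
Unset Printing Implicit Defensive.

Import Order.TTheory GRing.Theory Num.Theory.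
Local Open Scope ring_scope.

(* Conventions.  X = {1, ..., n} is represented by 'I_n, and an n-tuple of reals
   by an element of {ffun 'I_n -> R}; K^n is then the predicate ffun_on K.  A
   function J^n -> I (resp. J -> I) is a total function on all tuples (resp. all
   reals) of which only the restriction to J^n (resp. J) is ever constrained. *)

Section Defs.
Variables (R : realType) (n : nat).
Implicit Types (K : interval R) (a b c d : R).
Implicit Types (x y : {ffun 'I_n -> R}) (s : 'S_n) (S : {set 'I_n}).
Implicit Types (mu : {set 'I_n} -> R) (phi : R -> R) (f : {ffun 'I_n -> R} -> R).

Definition tmin x y : {ffun 'I_n -> R} := [ffun i => Num.min (x i) (y i)].
Definition tmax x y : {ffun 'I_n -> R} := [ffun i => Num.max (x i) (y i)].

Definition diag (t : R) : {ffun 'I_n -> R} := [ffun=> t].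

Definition eS c d S : {ffun 'I_n -> R} := [ffun i => if i \in S then d else c].

(* K^n_s *)
Definition sector K s : pred {ffun 'I_n -> R} :=
  [pred x | (x \in ffun_on K) &&
            [forall i : 'I_n, forall j : 'I_n, (i <= j)%N ==> (x (s i) <= x (s j))]].

Definition upset s (i : 'I_n) : {set 'I_n} := [set s j | j : 'I_n & (i <= j)%N].

Definition capacity a b mu : Prop :=
  [/\ forall S, mu S \in `[a, b],
      forall S T : {set 'I_n}, S \subset T -> mu S <= mu T,
      mu set0 = a &
      mu setT = b].

(* The neutral element a of the maximum is the least element of I = [a, b], so
   for n >= 1 it does not contribute on I^n. *)
Definition sugeno_formula a mu s x : R :=
  \big[Num.max/a]_(i < n) Num.min (x (s i)) (mu (upset s i)).

(* Evaluated at some s with x \in I^n_s; exists_sector shows that there is one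
   for each x in I^n, and sugenoE that the value does not depend on the choice.
   Outside I^n the value is irrelevant. *)
Definition sugeno a b mu x : R :=
  if [pick s : 'S_n | x \in sector `[a, b] s] is Some s
  then sugeno_formula a mu s x else a.

Definition nondecreasing_on c d f : Prop :=
  forall x y, x \in ffun_on `[c, d] -> y \in ffun_on `[c, d] ->
    (forall i, x i <= y i) -> f x <= f y.

Definition quasi_sugeno_form a b c d f mu phi : Prop :=
  [/\ capacity a b mu,
      {in `[c, d], forall t, phi t \in `[a, b]},
      {in `[c, d] &, {homo phi : t u / t <= u}} &
      forall x, x \in ffun_on `[c, d] ->
        f x = sugeno a b mu [ffun i => phi (x i)]].

Definition quasi_sugeno a b c d f : Prop :=
  exists mu phi, quasi_sugeno_form a b c d f mu phi.

Definition comonotonic c d x y : Prop :=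
  exists s : 'S_n, x \in sector `[c, d] s /\ y \in sector `[c, d] s.

Definition comonotonically_modular c d f : Prop :=
  forall x y, comonotonic c d x y -> f x + f y = f (tmin x y) + f (tmax x y).

Definition propA c d f : Prop :=
  forall (t : R) S, t \in `[c, d] ->
    f (tmax (diag t) (eS c d S)) = Num.max (f (diag t)) (f (eS c d S)).

Definition propB c d f : Prop :=
  forall (t : R) S, t \in `[c, d] ->
    f (tmin (diag t) (eS c d S)) = Num.min (f (diag t)) (f (eS c d S)).

Lemma exists_sector K x : x \in ffun_on K -> exists s, x \in sector K s.
Proof.
move=> xK; pose t := [tuple x i | i < n].
have /tuple_permP[p tp] : perm_eq (sort <=%R t) t by rewrite perm_sort.
exists p; rewrite inE xK; apply/forallP => i; apply/forallP => j.
apply/implyP => ij.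
have nthE (k : 'I_n) : nth 0 (sort <=%R t) k = x (p k).
  by rewrite tp -[k in nth _ _ k]/(nat_of_ord k) -tnth_nth !tnth_mktuple.
rewrite -!nthE; apply: (sorted_leq_nth le_trans lexx) => //.
- exact: sort_le_sorted.
- by rewrite inE size_sort size_tuple.
- by rewrite inE size_sort size_tuple.
Qed.

Lemma sector_le K s x (i j : 'I_n) :
  x \in sector K s -> (i <= j)%N -> x (s i) <= x (s j).
Proof. by case/andP=> _ /forallP/(_ i)/forallP/(_ j)/implyP. Qed.

Lemma sugeno_formula_le a b mu s s' x :
  capacity a b mu -> x \in sector `[a, b] s -> x \in sector `[a, b] s' ->
  sugeno_formula a mu s x <= sugeno_formula a mu s' x.
Proof.
move=> [muI muS _ _] xs xs'; apply/bigmax_leP; split => [|i _].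
  exact: bigmax_ge_id.
pose P (k : 'I_n) := x (s i) <= x (s' k).
have Pi : P (s'^-1%g (s i)) by rewrite /P permKV.
case: (arg_minnP (fun k : 'I_n => k : nat) Pi) => k Pk kmin.
apply: (le_trans _ (le_bigmax _ _ k)).
rewrite le_min !ge_min; apply/andP; split; first by apply/orP; left.
apply/orP; right; apply: muS; apply/subsetP => _ /imsetP[j + ->].
rewrite inE => ij; apply/imsetP; exists (s'^-1%g (s j)); last by rewrite permKV.
by rewrite inE; apply: kmin; rewrite /P permKV; apply: sector_le xs ij.
Qed.

Lemma sugenoE a b mu s x :
  capacity a b mu -> x \in sector `[a, b] s ->
  sugeno a b mu x = sugeno_formula a mu s x.
Proof.
move=> hmu xs; rewrite /sugeno; case: pickP => [s' xs'|/(_ s)].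
  by apply/eqP; rewrite eq_le !(sugeno_formula_le hmu).
by rewrite xs.
Qed.

End Defs.

Arguments diag {R} n t.

(* Main.v *)
Require Import Defs.
From HB Require Import structures.
From mathcomp Require Import all_boot all_order all_fingroup all_algebra.
From mathcomp Require Import reals.

Set Implicit Arguments.
Unset Strict Implicit.
Unset Printing Implicit Defensive.

Import Order.TTheory GRing.Theory Num.Theory.
Local Open Scope ring_scope.

(* For every t, the inequality t <= S_mu(x) holds iff t <= mu {i | t <= x_i}.
   This description by upper level sets does not mention the permutation sorting
   x, and all four conditions are read off it.  For comonotonic tuples the upper
   level sets are nested, so S_mu even turns their componentwise minimum and
   maximum into the minimum and maximum of the values.  Conversely, under (A)
   and (B), let A = {i | t <= f(x_i, ..., x_i)}, u the minimum of the x_i over A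
   and v their maximum off A: then u /\ e_A <= x <= v \/ e_A, and monotonicity
   gives t <= f(x) iff t <= f(e_A). *)

(** Reduces an equality of values of [f] to a comparison of the bounds below them, where level sets
    take over. *)
Lemma eq_from_le_left disp (T : porderType disp) (x y : T) :
  (forall t, (t <= x)%O = (t <= y)%O) -> x = y.
Proof. by move=> h; apply/le_anti; rewrite -h lexx h lexx. Qed.

(** * Level sets of tuples and the Sugeno integral *)

Section QuasiSugeno.
Variables (R : realType) (n : nat).
Implicit Types (x y : {ffun 'I_n -> R}) (S : {set 'I_n}).
Implicit Types (mu : {set 'I_n} -> R) (f : {ffun 'I_n -> R} -> R).

Lemma ffun_on_itvP (a b : R) x :
  reflect (forall i, a <= x i <= b) (x \in ffun_on `[a, b]).
Proof.
apply: (iffP ffun_onP) => h i; first by have := h i; rewrite in_itv.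
by rewrite in_itv; apply: h.
Qed.

Lemma tmin_on (a b : R) x y : x \in ffun_on `[a, b] -> y \in ffun_on `[a, b] ->
  tmin x y \in ffun_on `[a, b].
Proof.
move=> /ffun_on_itvP hx /ffun_on_itvP hy; apply/ffun_on_itvP => i.
by rewrite ffunE minEle; case: ifP.
Qed.

Lemma tmax_on (a b : R) x y : x \in ffun_on `[a, b] -> y \in ffun_on `[a, b] ->
  tmax x y \in ffun_on `[a, b].
Proof.
move=> /ffun_on_itvP hx /ffun_on_itvP hy; apply/ffun_on_itvP => i.
by rewrite ffunE maxEle; case: ifP.
Qed.

Lemma diag_on (a b t : R) : t \in `[a, b] -> diag n t \in ffun_on `[a, b].
Proof. by move=> ht; apply/ffun_onP => i; rewrite ffunE. Qed.

Lemma eS_on (c d : R) S : c <= d -> eS c d S \in ffun_on `[c, d].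
Proof.
by move=> cd; apply/ffun_on_itvP => i; rewrite ffunE; case: ifP; rewrite lexx cd.
Qed.

Lemma le_sugeno (a b : R) mu x (t : R) : capacity a b mu ->
  x \in ffun_on `[a, b] ->
  (t <= sugeno a b mu x) = (t <= mu [set i | t <= x i]).
Proof.
move=> hmu xI; have [s xs] := exists_sector xI; rewrite (sugenoE hmu xs).
have [muI muS mu0 _] := hmu.
(* For [t <= a] both sides are true. For [a < t] the default [a] of the big maximum stays below [t],
   and [mu set0 = a] excludes an empty level set. *)
have [ta|at_] := leP t a.
  have := muI [set i | t <= x i]; rewrite in_itv => /andP[aA _].
  by rewrite (le_trans ta aA) (le_trans ta) // bigmax_ge_id.
apply/idP/idP => [|tA].
  (* By contraposition: if [t <= x (s i)], then [upset s i] lies in the level set, so its capacity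
     is below [t]; hence every term is below [t]. *)
  rewrite leNgt => /negP h; case: (leP t) => // muAt; case: h.
  apply/bigmax_ltP; split=> // i _; rewrite gt_min ltNge.
  have [txi|//] := leP t (x (s i)); rewrite /=.
  apply: le_lt_trans muAt; apply: muS; apply/subsetP => _ /imsetP[j + ->].
  by rewrite !inE => ij; apply: le_trans txi (sector_le xs ij).
have [A0|[k0]] := set_0Vmem [set i | t <= x i].
  by move: tA; rewrite A0 mu0 leNgt at_.
(* The least rank [k] at which [x] reaches [t] gives a term that is large enough: [upset s k]
   contains the whole level set. *)
rewrite inE => tk0; pose P (k : 'I_n) := t <= x (s k).
have Pk0 : P (s^-1%g k0) by rewrite /P permKV.
case: (arg_minnP (fun k : 'I_n => k : nat) Pk0) => k Pk kmin.
apply: (le_trans _ (le_bigmax _ _ k)); rewrite le_min (Pk : t <= _) /=.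
apply: le_trans tA (muS _ _ _); apply/subsetP => j; rewrite inE => tj.
apply/imsetP; exists (s^-1%g j); last by rewrite permKV.
by rewrite inE; apply: kmin; rewrite /P permKV.
Qed.

(** In the order of a common sorting permutation both sets are final segments, and final segments
    form a chain. *)
Lemma comonotonic_nested (c d : R) x y (P : pred R) : comonotonic c d x y ->
  {in `[c, d] &, forall u v, u <= v -> P u -> P v} ->
  ([set i | P (x i)] \subset [set i | P (y i)]) ||
  ([set i | P (y i)] \subset [set i | P (x i)]).
Proof.
move=> [s [xs ys]] Pup.
have xJ i : x i \in `[c, d] by case/andP: xs => /ffun_onP.
have yJ i : y i \in `[c, d] by case/andP: ys => /ffun_onP.
apply/orP; case: (boolP (_ \subset _)) => [|/subsetPn[i]]; first by left.
rewrite !inE => Pxi nPyi; right; apply/subsetP => j; rewrite !inE => Pyj.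
have [ij|ji] := leqP (s^-1%g i) (s^-1%g j).
  have := sector_le xs ij; rewrite !permKV => xij.
  exact: Pup (xJ i) (xJ j) xij Pxi.
have := sector_le ys (ltnW ji); rewrite !permKV => yji.
by rewrite (Pup _ _ (yJ j) (yJ i) yji Pyj) in nPyi.
Qed.

(** * Lattice properties of quasi-Sugeno integrals *)

Section LevelSets.
Variables (a b c d : R) (mu : {set 'I_n} -> R) (phi : R -> R).
Variable f : {ffun 'I_n -> R} -> R.
Hypothesis fE : quasi_sugeno_form a b c d f mu phi.

Lemma le_quasi_sugeno x (t : R) : x \in ffun_on `[c, d] ->
  (t <= f x) = (t <= mu [set i | t <= phi (x i)]).
Proof.
move=> xJ; have [hmu phiI _ ->//] := fE; rewrite le_sugeno //.
  by congr (_ <= mu _); apply/setP => i; rewrite !inE ffunE.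
by apply/ffun_onP => i; rewrite ffunE; apply: phiI; apply: (ffun_onP xJ).
Qed.

Lemma quasi_sugeno_nondecreasing : nondecreasing_on c d f.
Proof.
move=> x y xJ yJ xy; have [[_ muS _ _] _ phi_mono _] := fE.
rewrite le_quasi_sugeno //.
have := lexx (f x); rewrite le_quasi_sugeno // => /le_trans; apply.
apply: muS; apply/subsetP => i; rewrite !inE => /le_trans; apply.
by apply: phi_mono; rewrite ?(ffun_onP xJ) ?(ffun_onP yJ).
Qed.

(** As [phi] is monotone, the level set of the minimum is [A :&: B]. The two sets being nested, this
    is the smaller one, whose capacity is the smaller value. *)
Lemma quasi_sugeno_tmin x y : comonotonic c d x y ->
  f (tmin x y) = Num.min (f x) (f y).
Proof.
move=> xy; have [[_ muS _ _] _ phi_mono _] := fE.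
have [xJ yJ] : x \in ffun_on `[c, d] /\ y \in ffun_on `[c, d].
  by case: xy => s [/andP[? _] /andP[? _]].
apply: eq_from_le_left => t; rewrite le_min !le_quasi_sugeno ?tmin_on //.
set A := [set i | t <= phi (x i)]; set B := [set i | t <= phi (y i)].
have -> : [set i | t <= phi (tmin x y i)] = A :&: B.
  apply/setP => i; rewrite !inE ffunE.
  have [xJi yJi] := (ffun_onP xJ i, ffun_onP yJ i).
  case: (leP (x i) (y i)) => [/(phi_mono _ _ xJi yJi) h|/ltW /(phi_mono _ _ yJi xJi) h].
    by case: (leP t (phi (x i))) => // tx; rewrite (le_trans tx h).
  case: (leP t (phi (y i))) => [ty|_]; last by rewrite andbF.
  by rewrite (le_trans ty h).
have := @comonotonic_nested c d x y (fun u => t <= phi u) xy.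
rewrite -/A -/B => /(_ _)/orP[u v uJ vJ uv /le_trans|AB|BA].
- by apply; apply: phi_mono.
- rewrite (setIidPl AB); case: (leP t (mu A)) => // tA.
  by rewrite (le_trans tA) ?muS.
- rewrite (setIidPr BA); case: (leP t (mu B)) => [tB|]; last by rewrite andbF.
  by rewrite (le_trans tB) ?muS.
Qed.

(** Dually, the level set of the maximum is the union, that is, the larger of two nested sets. *)
Lemma quasi_sugeno_tmax x y : comonotonic c d x y ->
  f (tmax x y) = Num.max (f x) (f y).
Proof.
move=> xy; have [[_ muS _ _] _ phi_mono _] := fE.
have [xJ yJ] : x \in ffun_on `[c, d] /\ y \in ffun_on `[c, d].
  by case: xy => s [/andP[? _] /andP[? _]].
apply: eq_from_le_left => t; rewrite le_max !le_quasi_sugeno ?tmax_on //.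
set A := [set i | t <= phi (x i)]; set B := [set i | t <= phi (y i)].
have -> : [set i | t <= phi (tmax x y i)] = A :|: B.
  apply/setP => i; rewrite !inE ffunE.
  have [xJi yJi] := (ffun_onP xJ i, ffun_onP yJ i).
  case: (leP (x i) (y i)) => [/(phi_mono _ _ xJi yJi) h|/ltW /(phi_mono _ _ yJi xJi) h].
    by case: (leP t (phi (x i))) => // tx; rewrite (le_trans tx h).
  case: (leP t (phi (y i))) => [ty|_]; last by rewrite orbF.
  by rewrite (le_trans ty h).
have := @comonotonic_nested c d x y (fun u => t <= phi u) xy.
rewrite -/A -/B => /(_ _)/orP[u v uJ vJ uv /le_trans|AB|BA].
- by apply; apply: phi_mono.
- rewrite (setUidPr AB); case: (leP t (mu A)) => // tA.
  by rewrite (le_trans tA) ?muS.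
- rewrite (setUidPl BA); case: (leP t (mu B)) => [tB|]; last by rewrite orbF.
  by rewrite (le_trans tB) ?muS.
Qed.

End LevelSets.

(** Every permutation sorts a constant tuple, so one that sorts [eS c d S] serves both. This makes
    (A), (B) and modularity speak about the same pair. *)
Lemma comonotonic_diag_eS (c d t : R) S : c <= d -> t \in `[c, d] ->
  comonotonic c d (diag n t) (eS c d S).
Proof.
move=> cd tJ; have [s es] := exists_sector (eS_on S cd); exists s; split=> //.
rewrite inE diag_on //; apply/forallP => i; apply/forallP => j.
by rewrite !ffunE lexx implybT.
Qed.

(* f (e_set0) > a and f (e_setT) < b may happen; overriding these two values is
   harmless because no upset s i is empty and f <= f (e_setT) on J^n. *)
Definition vertex_capacity (a b c d : R) f S : R :=
  if S == set0 then a else if S == setT then b else f (eS c d S).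

(** * Recovering the integral from (A) and (B) *)

Section FromAB.
Variables (a b c d : R) (f : {ffun 'I_n -> R} -> R).
Hypotheses (n_gt0 : (0 < n)%N) (ab : a <= b) (cd : c <= d).
Hypothesis fI : forall x, x \in ffun_on `[c, d] -> f x \in `[a, b].
Hypothesis f_mono : nondecreasing_on c d f.

Lemma vertex_capacityP : capacity a b (vertex_capacity a b c d f).
Proof.
have set0T : setT != set0 :> {set 'I_n}.
  by apply/set0Pn; exists (Ordinal n_gt0); rewrite inE.
have muI S : a <= vertex_capacity a b c d f S <= b.
  rewrite /vertex_capacity; do 2![case: ifP => _; first by rewrite lexx ab].
  by have := fI (eS_on S cd); rewrite in_itv.
split=> [S|S T ST||].
- by rewrite in_itv; apply: muI.
- have [->|S0] := eqVneq S set0.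
    by rewrite {1}/vertex_capacity eqxx; case/andP: (muI T).
  have [->|TT] := eqVneq T setT.
    by rewrite {2}/vertex_capacity (negPf set0T) eqxx; case/andP: (muI S).
  have T0 : T != set0 by apply: contraNneq S0 => T0; rewrite -subset0 -T0.
  have ST' : S != setT by apply: contraNneq TT => S1; rewrite -subTset -S1.
  rewrite /vertex_capacity (negPf S0) (negPf T0) (negPf ST') (negPf TT).
  apply: f_mono; rewrite ?eS_on // => i; rewrite !ffunE.
  by case: ifP => [/(subsetP ST) ->//|_]; case: ifP.
- by rewrite /vertex_capacity eqxx.
- by rewrite /vertex_capacity (negPf set0T) eqxx.
Qed.

Lemma diag_mono : {in `[c, d] &, {homo f \o diag n : t u / t <= u}}.
Proof.
by move=> t u tJ uJ tu; apply: f_mono; rewrite ?diag_on // => i; rewrite !ffunE.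
Qed.

Hypotheses (fA : propA c d f) (fB : propB c d f).

(** With [x i] the largest entry off [A], (A) bounds [f x] by the maximum of [f (diag n (x i))] and
    [f (eS c d A)]; the former is below [t] since [i] is not in [A]. *)
Lemma le_level_vertex x (t : R) : x \in ffun_on `[c, d] ->
  let A := [set i | t <= f (diag n (x i))] in
  A != setT -> t <= f x -> t <= f (eS c d A).
Proof.
move=> xJ A; rewrite -subTset => /subsetPn[i0 _ i0A] tfx.
case: (arg_maxP (P := fun i => i \notin A) x i0A) => i iA imax.
have : f x <= f (tmax (diag n (x i)) (eS c d A)).
  have xJi := ffun_onP xJ i.
  apply: f_mono => //; first by rewrite tmax_on ?diag_on ?eS_on.
  move=> j; rewrite !ffunE le_max; case: ifPn => [_|jA]; last first.
    by rewrite (imax j jA : x j <= x i).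
  by case/andP: (ffun_on_itvP _ _ _ xJ j) => _ ->; rewrite orbT.
move/(le_trans tfx); rewrite fA ?(ffun_onP xJ) // le_max => /orP[h|//].
by rewrite inE h in iA.
Qed.

(** Dual argument through (B), with [x i] the smallest entry on [A]. *)
Lemma vertex_le_level x (t : R) : x \in ffun_on `[c, d] ->
  let A := [set i | t <= f (diag n (x i))] in
  A != set0 -> t <= f (eS c d A) -> t <= f x.
Proof.
move=> xJ A /set0Pn[i0 i0A] tfA.
case: (arg_minP (P := fun i => i \in A) x i0A) => i iA imin.
have xJi := ffun_onP xJ i.
apply: (@le_trans _ _ (f (tmin (diag n (x i)) (eS c d A)))).
  by rewrite fB // le_min tfA andbT; rewrite inE in iA.
apply: f_mono => //; first by rewrite tmin_on ?diag_on ?eS_on.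
move=> j; rewrite !ffunE ge_min; case: ifPn => [jA|_].
  by rewrite (imin j jA : x i <= x j).
by case/andP: (ffun_on_itvP _ _ _ xJ j) => ->; rewrite orbT.
Qed.

Lemma vertex_capacity_form :
  quasi_sugeno_form a b c d f (vertex_capacity a b c d f) (fun t => f (diag n t)).
Proof.
split=> [|t tJ||x xJ]; first exact: vertex_capacityP.
- by rewrite fI ?diag_on.
- exact: diag_mono.
have fxI : a <= f x <= b by have := fI xJ; rewrite in_itv.
apply: eq_from_le_left => t; rewrite le_sugeno; first last.
- by apply/ffun_onP => i; rewrite ffunE fI // diag_on // (ffun_onP xJ).
- exact: vertex_capacityP.
have -> : [set i | t <= [ffun i => f (diag n (x i))] i]
        = [set i | t <= f (diag n (x i))] by apply/setP => i; rewrite !inE ffunE.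
have := @le_level_vertex x t xJ; have := @vertex_le_level x t xJ.
set A := [set i | _] => /= up dn; rewrite /vertex_capacity.
have i0 := Ordinal n_gt0; have i0J := ffun_onP xJ i0.
case: ifPn => [/eqP A0|AN0].
  (* For empty [A] the capacity is the overridden value [a]. Here [t <= f x] would force [t <= f (eS
     c d set0) <= f (diag n (x i0))], since [eS c d set0] is constantly [c], and so put [i0] in
     [A]. *)
  apply/idP/idP => [tfx|ta]; last by apply: le_trans ta _; case/andP: fxI.
  have /dn : A != setT by apply/eqP => A1; have := in_set0 i0; rewrite -A0 A1 inE.
  move=> /(_ tfx) tA; have : i0 \in A; last by rewrite A0 inE.
  rewrite inE; apply: le_trans tA (f_mono _ _ _); rewrite ?eS_on ?diag_on //.
  by move=> j; rewrite A0 !ffunE inE; case/andP: (ffun_on_itvP _ _ _ xJ i0).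
case: ifPn => [/eqP A1|AN1]; last by apply/idP/idP; [apply: dn|apply: up].
(* For full [A] the overridden value is [b], and both sides are true: [t <= f (diag n (x i0)) <= f
   (eS c d setT)], hence [t <= f x <= b]. *)
have tA : t <= f (eS c d A).
  have : i0 \in A by rewrite A1 inE.
  rewrite inE => /le_trans; apply; apply: f_mono; rewrite ?eS_on ?diag_on //.
  by move=> j; rewrite A1 !ffunE inE; case/andP: (ffun_on_itvP _ _ _ xJ i0).
have tfx := up AN0 tA; rewrite tfx; apply/esym/(le_trans tfx).
by case/andP: fxI.
Qed.

End FromAB.

End QuasiSugeno.

Theorem theorem20 (R : realType) (n : nat) (hn : (1 <= n)%N)
    (a b c d : R) (hab : a < b) (hcd : c < d)
    (f : {ffun 'I_n -> R} -> R)
    (hf : forall x : {ffun 'I_n -> R}, x \in ffun_on `[c, d] -> f x \in `[a, b]) :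
  [<-> exists mu : {set 'I_n} -> R,
         quasi_sugeno_form a b c d f mu (fun t : R => f (diag n t));
       quasi_sugeno a b c d f;
       [/\ comonotonically_modular c d f,
           nondecreasing_on c d f &
           propA c d f \/ propB c d f];
       [/\ nondecreasing_on c d f, propA c d f & propB c d f]].
Proof.
have cd := ltW hcd.
tfae.
- by case=> mu fE; exists mu, (fun t => f (diag n t)).
- case=> mu [phi fE]; split=> [x y xy||].
  + by rewrite (quasi_sugeno_tmin fE xy) (quasi_sugeno_tmax fE xy) addr_min_max.
  + exact: quasi_sugeno_nondecreasing fE.
  + left=> t S tJ; apply: (quasi_sugeno_tmax fE).
    exact: comonotonic_diag_eS.
(* Two reals have the same sum as their minimum and maximum. So in the modularity equation for
   [diag n t] and [eS c d S], knowing one term on the right yields the other by cancellation. *)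
- case=> f_mod f_mono fAB; split=> // t S tJ;
    have := f_mod _ _ (comonotonic_diag_eS S cd tJ); case: fAB => [fA|fB].
  + by rewrite fA.
  + by rewrite fB // -(addr_min_max (f (diag n t))) => /addrI ->.
  + by rewrite fA // -(addr_min_max (f (diag n t))) => /addIr ->.
  + by rewrite fB.
- case=> f_mono fA fB; exists (vertex_capacity a b c d f).
  by apply: vertex_capacity_form => //; apply: ltW.
Qed.
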